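(* Let $n\geq 1$. The following subgroups of $\mathcal S_n$ are non-nudgable: (i) the full group $\mathcal S_n$; (ii) the alternating group $\mathcal A_n$, if $\lfloor \frac n2\rfloor$ is even; (iii) the dihedral group $\mathcal D_n\subseteq \mathcal S_n$, i.e. the subgroup generated by $\omega_0$ and the cycle $(1\,2\,\cdots\, n)$, where $\omega_0\in\mathcal S_n$ is the permutation with $\omega_0(i)=n+1-i$ for all $i\in\{1,\ldots,n\}$.
   Context: $\mathcal S_n$ denotes the group of all permutations of $\{1,\ldots,n\}$ and $\mathcal A_n$ its subgroup of even permutations. For $\sigma\in\mathcal S_n$ the inversion set is $\mathrm{inv}(\sigma)=\{(i,j)\mid 1\leq i<j\leq n,\ \sigma(j)<\sigma(i)\}$. For a subgroup $G\subseteq\mathcal S_n$ and $\pi\in G$ put $D_G(\pi)=\{\sigma\in G\mid \mathrm{inv}(\sigma)\cap\mathrm{inv}(\pi)=\emptyset\}$. The subgroup $G\subseteq\mathcal S_n$ is called non-nudgable if $|D_G(\pi)|=|D_G(\pi^{-1})|$ for all $\pi\in G$; otherwise it is called nudgable. *)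

(* Defs.v *)
From mathcomp Require Import all_boot all_fingroup all_solvable.

Set Implicit Arguments.
Unset Strict Implicit.
Unset Printing Implicit Defensive.

Local Open Scope group_scope.

(* {1, ..., n} is represented by 'I_n = {0, ..., n-1}, i.e. shifted by one. *)

Definition inversions (n : nat) (s : 'S_n) : {set 'I_n * 'I_n} :=
  [set p : 'I_n * 'I_n | (p.1 < p.2) && (s p.2 < s p.1)].

Definition Dset (n : nat) (G : {group 'S_n}) (p : 'S_n) : {set 'S_n} :=
  [set s in G | inversions s :&: inversions p == set0].

Definition non_nudgable (n : nat) (G : {group 'S_n}) : Prop :=
  forall p : 'S_n, p \in G -> #|Dset G p| = #|Dset G p^-1|.

(* i |-> n + 1 - i on {1, ..., n} becomes i |-> n - 1 - i on 'I_n. *)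
Definition omega0 (n : nat) : 'S_n := perm (@rev_ord_inj n).

(* The cycle (1 2 ... n) becomes i |-> i + 1 mod n on 'I_n. *)
Definition long_cycle (n : nat) : 'S_n := perm (@ordS_inj n).

(* Defined as a subgroup of 'S_n, so for n <= 2 its order is not 2 * n. *)
Definition dihedral_perm (n : nat) : {group 'S_n} :=
  <<[set omega0 n; long_cycle n]>>%G.

(* Main.v *)
Require Import Defs.
From mathcomp Require Import all_boot all_fingroup all_solvable.

(** Each of these groups contains omega0, and that alone suffices.  If inv(s)
    and inv(p) are disjoint and (a, b) is an inversion of p^-1, then
    (p^-1 b, p^-1 a) is an inversion of p, hence not one of s, so s o p^-1
    inverts (a, b) and omega0 o s o p^-1 does not.  Thus
    s |-> omega0 o s o p^-1 injects D_G(p) into D_G(p^-1); replacing p by p^-1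
    gives the reverse inequality. *)

(* Products in 'S_n act from the left factor on: (p^-1 * s * omega0 n) is
   omega0 o s o p^-1. *)
Lemma Dset_omega0 (n : nat) (G : {group 'S_n}) (p s : 'S_n) :
  omega0 n \in G -> p \in G -> s \in Dset G p ->
  (p^-1 * s * omega0 n)%g \in Dset G p^-1%g.
Proof.
move=> Gw Gp; rewrite !inE => /andP[Gs /eqP dis].
rewrite !groupM ?groupV //=; apply/eqP/setP=> -[a b].
rewrite !inE !permM /=; apply/negP => /andP[/andP[ltab lt_w] /andP[_ lt_p]].
have := in_set0 (p^-1 b, p^-1 a)%g; rewrite -dis !inE /= lt_p !permKV ltab andbT.
(* As [omega0] reverses the order, [lt_w] says that [s] after [p^-1] keeps [a] and [b] in order, so
   the pair is an inversion of [s]. *)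
by move: lt_w; rewrite !permE /= ltn_sub2lE ?ltn_ord // ltnS => ->.
Qed.

Lemma leq_card_Dset (n : nat) (G : {group 'S_n}) (p : 'S_n) :
  omega0 n \in G -> p \in G -> #|Dset G p| <= #|Dset G p^-1%g|.
Proof.
move=> Gw Gp; have inj_f : injective (fun s => p^-1 * s * omega0 n)%g.
  by move=> s t /mulIg/mulgI.
rewrite -(card_imset _ inj_f); apply/subset_leq_card/subsetP => _ /imsetP[s Ds ->].
exact: Dset_omega0.
Qed.

Lemma non_nudgable_omega0 (n : nat) (G : {group 'S_n}) :
  omega0 n \in G -> non_nudgable G.
Proof.
move=> Gw p Gp; apply/eqP; rewrite eqn_leq leq_card_Dset //=.
by rewrite -[X in _ <= #|Dset G X|]invgK leq_card_Dset ?groupV.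
Qed.

(** Recursion for the sign: deleting the point 0 and its image, the last value, leaves the smaller
    reversal. *)
Lemma omega0S (n : nat) : omega0 n.+1 = lift_perm ord0 ord_max (omega0 n).
Proof.
apply/permP => i; case: (unliftP ord0 i) => [k|] ->; apply: val_inj.
  by rewrite lift_perm_lift [RHS]lift_max !permE /= subSS.
by rewrite lift_perm_id permE /= subSS subn0.
Qed.

(** The lift sending 0 to [n] flips the parity exactly when [n] is odd, and
    [n./2 + odd n = n.+1./2]. *)
Lemma odd_omega0 (n : nat) : odd_perm (omega0 n) = odd n./2.
Proof.
elim: n => [|n IHn].
  by rewrite (_ : omega0 0 = 1%g) ?odd_perm1 //; apply/permP => -[].
by rewrite omega0S odd_lift_perm IHn /= uphalf_half oddD oddb.
Qed.

Theorem corollary3p2 (n : nat) (hn : 1 <= n) :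
  [/\ non_nudgable 'Sym_('I_n)%G,
      ~~ odd (n %/ 2) -> non_nudgable 'Alt_('I_n)%G
    & non_nudgable (dihedral_perm n)].
Proof.
split=> [|even_half|]; apply: non_nudgable_omega0.
- by rewrite inE.
- by rewrite Alt_even odd_omega0 -divn2.
- by apply: mem_gen; rewrite !inE eqxx.
Qed.
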